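(* Let $\mathcal{C}$ be a nontrivial root class of groups closed under taking quotient groups. Let $A$ and $B$ be nilpotent groups belonging to $\mathcal{C}$, let $H \leqslant A$ and $K \leqslant B$ be subgroups, let $\varphi\colon H \to K$ be an isomorphism, and let $G = \langle A * B;\ H = K,\ \varphi \rangle$ be the free product of $A$ and $B$ with the subgroups $H$ and $K$ amalgamated according to $\varphi$. Suppose that $A$ and $B$ possess central series $$1 = A_0 \leqslant A_1 \leqslant \ldots \leqslant A_n = A, \qquad 1 = B_0 \leqslant B_1 \leqslant \ldots \leqslant B_n = B$$ (of the same length $n$) such that $(A_i \cap H)\varphi = B_i \cap K$ for every $i \in \{1, 2, \ldots, n\}$. Then there exists a homomorphism of $G$ onto a solvable group belonging to $\mathcal{C}$ which is injective on $A$ and on $B$. In particular, $G$ is residually a $\mathcal{CS}$-group, where $\mathcal{CS}$ is the class of all solvable groups belonging to $\mathcal{C}$.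
   Context: As usual, a class of groups is assumed to be closed under isomorphism; a $\mathcal{C}$-group is a group belonging to $\mathcal{C}$. A class of groups $\mathcal{C}$ is called a root class if (1) every subgroup of a $\mathcal{C}$-group is a $\mathcal{C}$-group; (2) the direct product of any two $\mathcal{C}$-groups belongs to $\mathcal{C}$; (3) (Gruenberg condition) for any group $X$ and any subnormal sequence $Z \leqslant Y \leqslant X$ with factors in $\mathcal{C}$ (that is, $Z$ is normal in $Y$, $Y$ is normal in $X$, and $Y/Z, X/Y \in \mathcal{C}$), there exists a normal subgroup $T$ of $X$ such that $T \leqslant Z$ and $X/T \in \mathcal{C}$. A class of groups is nontrivial if it contains at least one group with more than one element. Maps are written on the right: $(S)\varphi$ denotes the image of $S$ under $\varphi$. The group $G = \langle A * B;\ H = K,\ \varphi \rangle$ is the quotient of the free product $A * B$ by the normal closure of $\{h (h\varphi)^{-1} \mid h \in H\}$; $A$ and $B$ are regarded as subgroups of $G$ via the canonical embeddings. A series $1 = A_0 \leqslant A_1 \leqslant \ldots \leqslant A_n = A$ is central if each $A_i$ is normal in $A$ and $A_{i+1}/A_i$ lies in the center of $A/A_i$. A group $G$ is residually a $\mathcal{D}$-group, for a class of groups $\mathcal{D}$, if for every $g \in G \setminus \{1\}$ there is a homomorphism of $G$ onto a group in $\mathcal{D}$ under which the image of $g$ is nontrivial. *)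

(* Defs.v *)
From HB Require Import structures.
From mathcomp Require Import all_boot.
From mathcomp Require Import boolp classical_sets.

Set Implicit Arguments.
Unset Strict Implicit.
Unset Printing Implicit Defensive.

Local Open Scope classical_set_scope.
Local Open Scope quotient_scope.
Local Open Scope group_scope.

(* Groups are MathComp's (possibly infinite) [groupType]s, homomorphisms are
   [{multiplicative G -> H}], and the subgroups of [G] are the terms of type
   [groupClosed G]; since [boolp] identifies Prop with bool, every subset of [G]
   is given by a boolean predicate, so this covers all the subgroups. *)

HB.mixin Record isConjClosed (G : groupType) (S : {pred G}) := {
  gpredJr : forall x y : G, x \in S -> x ^ y \in S
}.

#[short(type="normalClosed")]
HB.structure Definition NormalClosed G :=
  {S of isConjClosed G S & GroupClosed G S}.

Section Subgroup.
Variables (G : groupType) (H : groupClosed G).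

Definition subgroup : Type := {x : G | x \in H}.

Fact subgroup_closed : group_closed (fun x : G => x \in H).
Proof. by split=> [|x y]; [apply: gpred1 | apply: gpredF]. Qed.

HB.instance Definition _ := SubChoice.on subgroup.
HB.instance Definition _ :=
  SubChoice_isSubGroup.Build G (fun x : G => x \in H) subgroup subgroup_closed.

End Subgroup.

Section Quotient.
Variables (G : groupType) (N : normalClosed G).

Definition coset_rel (x y : G) : bool := x^-1 * y \in N.

Fact coset_rel_refl : reflexive coset_rel.
Proof. by move=> x; rewrite /coset_rel mulVg gpred1. Qed.

Fact coset_rel_sym : symmetric coset_rel.
Proof. by move=> x y; rewrite /coset_rel -gpredV invgM invgK. Qed.

Fact coset_rel_trans : transitive coset_rel.
Proof.
move=> y x z Nxy Nyz; rewrite /coset_rel -[z](mulVKg y) mulgA.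
exact: gpredM.
Qed.

Canonical coset_equiv := EquivRel coset_rel
  coset_rel_refl coset_rel_sym coset_rel_trans.

Definition quotient : Type := {eq_quot coset_equiv}.
HB.instance Definition _ := Choice.on quotient.
HB.instance Definition _ := EqQuotient.on quotient.

Definition coset (x : G) : quotient := \pi_quotient x.

Definition quotient_mul (u v : quotient) : quotient :=
  coset (repr u * repr v).
Definition quotient_inv (u : quotient) : quotient := coset (repr u)^-1.

Fact coset_eqP x y : reflect (coset x = coset y) (coset_rel x y).
Proof. exact: (iffP (eqmodP _ _ _)). Qed.

Fact repr_cosetP x : coset_rel (repr (coset x)) x.
Proof. by apply/coset_eqP; rewrite /coset reprK. Qed.

Fact cosetM x y : coset (x * y) = quotient_mul (coset x) (coset y).
Proof.
apply/esym/coset_eqP; rewrite /coset_rel invgM.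
set x' := repr (coset x); set y' := repr (coset y).
have Nx : x'^-1 * x \in N by exact: repr_cosetP.
have Ny : y'^-1 * y \in N by exact: repr_cosetP.
have -> : y'^-1 * x'^-1 * (x * y) = (x'^-1 * x) ^ y' * (y'^-1 * y).
  by rewrite /conjg !mulgA mulgK.
by apply: gpredM => //; apply: gpredJr.
Qed.

Fact cosetV x : coset x^-1 = quotient_inv (coset x).
Proof.
apply/esym/coset_eqP; rewrite /coset_rel invgK.
set x' := repr (coset x).
have Nx : x'^-1 * x \in N by exact: repr_cosetP.
have -> : x' * x^-1 = ((x'^-1 * x)^-1) ^ x'^-1.
  by rewrite /conjg !invgM !invgK !mulgA mulgK.
by apply: gpredJr; apply: gpredVr.
Qed.

Fact quotient_ind (P : quotient -> Prop) :
  (forall x, P (coset x)) -> forall u, P u.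
Proof. by move=> Px u; rewrite -[u]reprK; apply: Px. Qed.

Fact quotient_mulA : associative quotient_mul.
Proof.
elim/quotient_ind=> x; elim/quotient_ind=> y; elim/quotient_ind=> z.
by rewrite -!cosetM mulgA.
Qed.

Fact quotient_1mul : left_id (coset 1) quotient_mul.
Proof. by elim/quotient_ind=> x; rewrite -cosetM mul1g. Qed.

Fact quotient_mul1 : right_id (coset 1) quotient_mul.
Proof. by elim/quotient_ind=> x; rewrite -cosetM mulg1. Qed.

Fact quotient_Vmul : left_inverse (coset 1) quotient_inv quotient_mul.
Proof. by elim/quotient_ind=> x; rewrite -cosetV -cosetM mulVg. Qed.

Fact quotient_mulV : right_inverse (coset 1) quotient_inv quotient_mul.
Proof. by elim/quotient_ind=> x; rewrite -cosetV -cosetM mulgV. Qed.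

HB.instance Definition _ := isGroup.Build quotient
  quotient_mulA quotient_1mul quotient_mul1 quotient_Vmul quotient_mulV.

HB.instance Definition _ := isMultiplicative.Build G quotient coset cosetM.

End Quotient.

Section Generation.
Variables (G : groupType) (P : set G).

Definition generated : {pred G} :=
  fun x => `[< forall S : groupClosed G, {in P, forall y, y \in S} -> x \in S >].

Fact generated1 : 1 \in generated.
Proof. by apply/asboolP => S _; apply: gpred1. Qed.

Fact generatedM : mulg_closed generated.
Proof.
move=> x y /asboolP Sx /asboolP Sy; apply/asboolP => S PS.
by apply: gpredM; [apply: Sx | apply: Sy].
Qed.

Fact generatedV : invg_closed generated.
Proof.
move=> x /asboolP Sx; apply/asboolP => S PS.
by apply: gpredVr; apply: Sx.
Qed.

HB.instance Definition _ := isMulClosed.Build G generated generatedM.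
HB.instance Definition _ := isMul1Closed.Build G generated generated1.
HB.instance Definition _ := isInvClosed.Build G generated generatedV.

Definition normal_closure : {pred G} :=
  fun x => `[< forall S : normalClosed G, {in P, forall y, y \in S} -> x \in S >].

Fact normal_closure1 : 1 \in normal_closure.
Proof. by apply/asboolP => S _; apply: gpred1. Qed.

Fact normal_closureM : mulg_closed normal_closure.
Proof.
move=> x y /asboolP Sx /asboolP Sy; apply/asboolP => S PS.
by apply: gpredM; [apply: Sx | apply: Sy].
Qed.

Fact normal_closureV : invg_closed normal_closure.
Proof.
move=> x /asboolP Sx; apply/asboolP => S PS.
by apply: gpredVr; apply: Sx.
Qed.

Fact normal_closureJ x y : x \in normal_closure -> x ^ y \in normal_closure.
Proof.
move=> /asboolP Sx; apply/asboolP => S PS.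
by apply: gpredJr; apply: Sx.
Qed.

HB.instance Definition _ := isMulClosed.Build G normal_closure normal_closureM.
HB.instance Definition _ := isMul1Closed.Build G normal_closure normal_closure1.
HB.instance Definition _ := isInvClosed.Build G normal_closure normal_closureV.
HB.instance Definition _ := isConjClosed.Build G normal_closure normal_closureJ.

End Generation.

(* A * B is the set of words over the disjoint union of A and B, modulo the
   congruence that multiplies out adjacent letters of the same factor and erases
   the units of A and B. *)
Section FreeProduct.
Variables A B : groupType.

Definition word : Type := seq (A + B).

Inductive word_eq : word -> word -> Prop :=
| word_eq_refl w : word_eq w w
| word_eq_sym v w : word_eq v w -> word_eq w v
| word_eq_trans u v w : word_eq u v -> word_eq v w -> word_eq u w
| word_eq_cat u v w t : word_eq u v -> word_eq w t -> word_eq (u ++ w) (v ++ t)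
| word_eq_1l : word_eq [:: inl 1] [::]
| word_eq_1r : word_eq [:: inr 1] [::]
| word_eq_Ml a a' : word_eq [:: inl a; inl a'] [:: inl (a * a')]
| word_eq_Mr b b' : word_eq [:: inr b; inr b'] [:: inr (b * b')].

Definition word_eqb (v w : word) : bool := `[< word_eq v w >].

Fact word_eqb_refl : reflexive word_eqb.
Proof. by move=> w; apply/asboolP; constructor. Qed.

Fact word_eqb_sym : symmetric word_eqb.
Proof. by move=> v w; apply/asboolP/asboolP; apply: word_eq_sym. Qed.

Fact word_eqb_trans : transitive word_eqb.
Proof.
by move=> v u w /asboolP uv /asboolP vw; apply/asboolP; apply: word_eq_trans vw.
Qed.

Canonical word_equiv := EquivRel word_eqb
  word_eqb_refl word_eqb_sym word_eqb_trans.

Definition free_product : Type := {eq_quot word_equiv}.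
HB.instance Definition _ := Choice.on free_product.
HB.instance Definition _ := EqQuotient.on free_product.

Definition word_class (w : word) : free_product := \pi_free_product w.

Definition letter_inv (s : A + B) : A + B :=
  match s with inl a => inl a^-1 | inr b => inr b^-1 end.
Definition word_inv (w : word) : word := rev (map letter_inv w).

Definition free_product_mul (u v : free_product) : free_product :=
  word_class (repr u ++ repr v).
Definition free_product_inv (u : free_product) : free_product :=
  word_class (word_inv (repr u)).

Fact word_classP v w : word_class v = word_class w <-> word_eq v w.
Proof. by split=> [/eqmodP/asboolP | vw]; last apply/eqmodP/asboolP. Qed.

Fact repr_word_class w : word_eq (repr (word_class w)) w.
Proof. by apply/word_classP; rewrite /word_class reprK. Qed.

Fact word_eq_inv v w : word_eq v w -> word_eq (word_inv v) (word_inv w).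
Proof.
elim=> {v w} [w|v w _|u v w _ uv _ vw|u v w t _ uv _ wt||||].
- exact: word_eq_refl.
- exact: word_eq_sym.
- exact: word_eq_trans vw.
- by rewrite /word_inv !map_cat !rev_cat; apply: word_eq_cat.
- by rewrite /word_inv /= invg1; apply: word_eq_1l.
- by rewrite /word_inv /= invg1; apply: word_eq_1r.
- by move=> a a'; rewrite /word_inv /= invgM; apply: word_eq_Ml.
- by move=> b b'; rewrite /word_inv /= invgM; apply: word_eq_Mr.
Qed.

Fact word_classM v w :
  word_class (v ++ w) = free_product_mul (word_class v) (word_class w).
Proof.
apply/word_classP/word_eq_sym.
by apply: word_eq_cat; apply: repr_word_class.
Qed.

Fact word_classV w : word_class (word_inv w) = free_product_inv (word_class w).
Proof.
by apply/word_classP/word_eq_sym/word_eq_inv/repr_word_class.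
Qed.

Fact free_product_ind (P : free_product -> Prop) :
  (forall w, P (word_class w)) -> forall u, P u.
Proof. by move=> Pw u; rewrite -[u]reprK; apply: Pw. Qed.

Fact word_mulV w : word_eq (word_inv w ++ w) [::].
Proof.
elim: w => [|s w IHw]; first exact: word_eq_refl.
rewrite /word_inv /= rev_cons cat_rcons -[s :: w]cat1s -cat1s (catA [:: _]).
apply: word_eq_trans IHw; apply: word_eq_cat; first exact: word_eq_refl.
rewrite -[X in word_eq _ X]cat0s; apply: word_eq_cat; last exact: word_eq_refl.
case: s => [a|b] /=.
  by apply: word_eq_trans word_eq_1l; rewrite -(mulVg a); apply: word_eq_Ml.
by apply: word_eq_trans word_eq_1r; rewrite -(mulVg b); apply: word_eq_Mr.
Qed.

Fact word_invK : involutive word_inv.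
Proof.
move=> w; rewrite /word_inv map_rev revK -map_comp -[RHS]map_id.
by apply: eq_map => -[x|x] /=; rewrite invgK.
Qed.

Fact free_product_mulA : associative free_product_mul.
Proof.
elim/free_product_ind=> u; elim/free_product_ind=> v; elim/free_product_ind=> w.
by rewrite -!word_classM catA.
Qed.

Fact free_product_1mul : left_id (word_class [::]) free_product_mul.
Proof. by elim/free_product_ind=> w; rewrite -word_classM. Qed.

Fact free_product_mul1 : right_id (word_class [::]) free_product_mul.
Proof. by elim/free_product_ind=> w; rewrite -word_classM cats0. Qed.

Fact free_product_Vmul :
  left_inverse (word_class [::]) free_product_inv free_product_mul.
Proof.
elim/free_product_ind=> w; rewrite -word_classV -word_classM.
exact/word_classP/word_mulV.
Qed.

Fact free_product_mulV :
  right_inverse (word_class [::]) free_product_inv free_product_mul.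
Proof.
elim/free_product_ind=> w; rewrite -word_classV -word_classM.
by apply/word_classP; rewrite -[X in X ++ _]word_invK; apply: word_mulV.
Qed.

HB.instance Definition _ := isGroup.Build free_product
  free_product_mulA free_product_1mul free_product_mul1
  free_product_Vmul free_product_mulV.

Definition free_inl (a : A) : free_product := word_class [:: inl a].
Definition free_inr (b : B) : free_product := word_class [:: inr b].

Fact free_inlM : {morph free_inl : x y / x * y}.
Proof.
move=> x y; rewrite -[RHS]word_classM.
exact/word_classP/word_eq_sym/word_eq_Ml.
Qed.

Fact free_inrM : {morph free_inr : x y / x * y}.
Proof.
move=> x y; rewrite -[RHS]word_classM.
exact/word_classP/word_eq_sym/word_eq_Mr.
Qed.

HB.instance Definition _ := isMultiplicative.Build A free_product free_inl free_inlM.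
HB.instance Definition _ := isMultiplicative.Build B free_product free_inr free_inrM.

End FreeProduct.

Section AmalgamatedProduct.
Variables (A B : groupType) (H : groupClosed A) (K : groupClosed B).
Variable phi : subgroup H -> subgroup K.

Definition amalgam_relators : set (free_product A B) :=
  [set free_inl B (val h) * (free_inr A (val (phi h)))^-1
     | h in [set: subgroup H]].

Definition amalgam_kernel : normalClosed (free_product A B) :=
  normal_closure amalgam_relators.

Definition amalgam : groupType := quotient amalgam_kernel.

Definition amalgam_inl (a : A) : amalgam := coset amalgam_kernel (free_inl B a).
Definition amalgam_inr (b : B) : amalgam := coset amalgam_kernel (free_inr A b).

Fact amalgam_inlM : {morph amalgam_inl : x y / x * y}.
Proof. by move=> x y; rewrite /amalgam_inl !gmulfM. Qed.

Fact amalgam_inrM : {morph amalgam_inr : x y / x * y}.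
Proof. by move=> x y; rewrite /amalgam_inr !gmulfM. Qed.

HB.instance Definition _ := isMultiplicative.Build A amalgam amalgam_inl amalgam_inlM.
HB.instance Definition _ := isMultiplicative.Build B amalgam amalgam_inr amalgam_inrM.

End AmalgamatedProduct.

Definition central_series (G : groupType) (n : nat) (S : nat -> normalClosed G) :=
  [/\ S 0 =i pred1 1,
      S n =i G,
      forall i, i < n -> {subset S i <= S i.+1}
    & forall i, i < n -> forall x, x \in S i.+1 ->
        forall u : quotient (S i), commute (coset (S i) x) u].

Definition nilpotent_group (G : groupType) : Prop :=
  exists n (S : nat -> normalClosed G), central_series n S.

Fixpoint derived_series (G : groupType) (n : nat) : groupClosed G :=
  if n is m.+1 then
    generated [set z | exists x y, [/\ x \in derived_series G m,
      y \in derived_series G m & z = [~ x, y]]]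
  else generated [set: G].

Definition solvable_group (G : groupType) : Prop :=
  exists n, derived_series G n =i pred1 1.

Definition iso_closed (C : groupType -> Prop) : Prop :=
  forall (X Y : groupType) (f : {multiplicative X -> Y}),
    bijective f -> C X -> C Y.

(* A subnormal sequence Z <= Y <= X is given by a normal subgroup Y of X and a
   normal subgroup Z of the group Y. *)
Definition Gruenberg_condition (C : groupType -> Prop) : Prop :=
  forall (X : groupType) (Y : normalClosed X) (Z : normalClosed (subgroup Y)),
    C (quotient Z) -> C (quotient Y) ->
  exists T : normalClosed X,
    (forall x, x \in T -> exists2 z : subgroup Y, z \in Z & val z = x)
    /\ C (quotient T).

Record root_class (C : groupType -> Prop) : Prop := RootClass {
  root_class_iso : iso_closed C;
  root_class_sub : forall (X : groupType) (Y : groupClosed X),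
    C X -> C (subgroup Y);
  root_class_prod : forall X Y : groupType, C X -> C Y -> C (X * Y)%type;
  root_class_Gruenberg : Gruenberg_condition C
}.

Definition nontrivial_class (C : groupType -> Prop) : Prop :=
  exists2 X : groupType, C X & exists x : X, x <> 1.

Definition quotient_closed (C : groupType -> Prop) : Prop :=
  forall (X : groupType) (N : normalClosed X), C X -> C (quotient N).

Definition surjective (X Y : Type) (f : X -> Y) : Prop :=
  forall y, exists x, f x = y.

Definition residually (D : groupType -> Prop) (G : groupType) : Prop :=
  forall g : G, g <> 1 ->
  exists (Q : groupType) (f : {multiplicative G -> Q}),
    [/\ D Q, surjective f & f g <> 1].

Definition solvable_in (C : groupType -> Prop) (X : groupType) : Prop :=
  C X /\ solvable_group X.

(* Main.v *)
(* Given al : G -> Q and f : G -> Q -> P with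
   f(ab)(z) = f(a)(z) f(b)(z al(a)), the map a |-> (f a, al a) is a homomorphism
   to the unrestricted wreath product of P by Q. The Gruenberg condition, applied
   to the base group and its functions vanishing at 1, puts this wreath product
   in C when P and Q are, since those functions contain no nontrivial normal
   subgroup of it.

   Embedding A and B compatibly.  Descend along the series: suppose that A and B
   map to Q with kernels A_(i+1), B_(i+1), compatibly on H. Let P be the centre of
   (A/A_i x B/B_i) / {(h, phi(h)^-1) : h in A_(i+1)}. As A_(i+1)/A_i is central, a
   transversal turns A_(i+1) -> P into a cocycle on A, constant in z on A_(i+1);
   likewise for B. On H the two cocycles differ by one that is trivial on the
   kernel of H -> Q, hence by a coboundary (coefficients are coinduced), so
   twisting the one on B makes them agree on H and yields maps to the wreath
   product of P by Q with kernels A_i, B_i.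

   Residuality.  Twist the trivial cocycle on B by a function m on Q constant on
   the left cosets of H; the resulting maps of A and B still agree on H. For a
   reduced word s t w assume that in Q no nonempty prefix of t w lies in H. Along
   the path 1, s, st, ... the coset sH is then visited only once, so with m
   supported on sH the base component at 1 of every prefix of s t w of length at
   least 2 is a nontrivial value of m or its inverse. By induction every reduced
   word is kept out of H in some solvable C-quotient. *)

Require Import Defs.
From HB Require Import structures.
From mathcomp Require Import all_boot.
From mathcomp Require Import boolp classical_sets.

Set Implicit Arguments.
Unset Strict Implicit.
Unset Printing Implicit Defensive.

Local Open Scope classical_set_scope.
Local Open Scope group_scope.

(** * Homomorphisms, subgroups and quotient groups *)

Section Morphisms.
Variables (X Y : groupType) (f : {multiplicative X -> Y}).

Lemma morph_1 : f 1 = 1.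
Proof. by apply: (@mulgI _ (f 1)); rewrite -gmulfM !mulg1. Qed.

Lemma morph_V : {morph f : x / x^-1}.
Proof. by move=> x; apply/esym/mulg1_eq; rewrite -gmulfM mulgV morph_1. Qed.

Lemma morph_J : {morph f : x y / x ^ y}.
Proof. by move=> x y; rewrite /conjg !gmulfM morph_V. Qed.

Lemma morph_inj : (forall x, f x = 1 -> x = 1) -> injective f.
Proof.
by move=> f1 x y fxy; apply/divg1_eq/f1; rewrite gmulfM morph_V fxy mulgV.
Qed.

End Morphisms.

Lemma multiplicative_of (X Y : groupType) (f : X -> Y) :
  {morph f : x y / x * y} -> exists g : {multiplicative X -> Y}, g =1 f.
Proof.
move=> fM.
pose m := isMultiplicative.Build X Y f fM.
pose g : {multiplicative X -> Y} := HB.pack f m.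
by exists g.
Qed.

Lemma groupClosed_of (X : groupType) (P : X -> Prop) :
  P 1 -> (forall x y, P x -> P y -> P (x * y)) -> (forall x, P x -> P x^-1) ->
  exists S : groupClosed X, forall x, x \in S <-> P x.
Proof.
move=> P1 PM PV; pose p : {pred X} := fun x => `[< P x >].
have p1 : 1 \in p by apply/asboolP.
have pM : mulg_closed p.
  by move=> x y /asboolP Px /asboolP Py; apply/asboolP; apply: PM.
have pV : invg_closed p by move=> x /asboolP Px; apply/asboolP; apply: PV.
pose m1 := isMul1Closed.Build X p p1.
pose m2 := isMulClosed.Build X p pM.
pose m3 := isInvClosed.Build X p pV.
pose S : groupClosed X := HB.pack p m1 m2 m3.
by exists S => x; split=> /asboolP.
Qed.

Lemma trivial_groupClosed (X : groupType) :
  exists S : groupClosed X, forall x, x \in S <-> x = 1.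
Proof.
apply: groupClosed_of => // [x y -> ->|x ->]; first by rewrite mulg1.
by rewrite invg1.
Qed.

Lemma normalClosed_of (X : groupType) (P : X -> Prop) :
  P 1 -> (forall x y, P x -> P y -> P (x * y)) -> (forall x, P x -> P x^-1) ->
  (forall x y, P x -> P (x ^ y)) ->
  exists S : normalClosed X, forall x, x \in S <-> P x.
Proof.
move=> P1 PM PV PJ; pose p : {pred X} := fun x => `[< P x >].
have p1 : 1 \in p by apply/asboolP.
have pM : mulg_closed p.
  by move=> x y /asboolP Px /asboolP Py; apply/asboolP; apply: PM.
have pV : invg_closed p by move=> x /asboolP Px; apply/asboolP; apply: PV.
have pJ x y : x \in p -> x ^ y \in p.
  by move=> /asboolP Px; apply/asboolP; apply: PJ.
pose m1 := isMul1Closed.Build X p p1.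
pose m2 := isMulClosed.Build X p pM.
pose m3 := isInvClosed.Build X p pV.
pose m4 := isConjClosed.Build X p pJ.
pose S : normalClosed X := HB.pack p m1 m2 m3 m4.
by exists S => x; split=> /asboolP.
Qed.

Lemma subgroup_mem (X : groupType) (S : groupClosed X) x :
  x \in S -> exists y : subgroup S, val y = x.
Proof. by move=> xS; exists (exist (fun y => y \in S) x xS). Qed.

Lemma subgroup_valV (X : groupType) (S : groupClosed X) (x : subgroup S) :
  val x^-1 = (val x)^-1.
Proof. exact: (morph_V (val : {multiplicative subgroup S -> X})). Qed.

Lemma kernel_normalClosed (X Y : groupType) (f : {multiplicative X -> Y}) :
  exists S : normalClosed X, forall x, x \in S <-> f x = 1.
Proof.
apply: normalClosed_of => [|x y|x|x y]; first by rewrite morph_1.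
- by rewrite gmulfM => -> ->; rewrite mulg1.
- by rewrite morph_V => ->; rewrite invg1.
by rewrite morph_J => ->; rewrite conj1g.
Qed.

Lemma coset_eq (X : groupType) (N : normalClosed X) x y :
  coset N x = coset N y <-> x^-1 * y \in N.
Proof. by split=> [/coset_eqP|xy]; last apply/coset_eqP. Qed.

Lemma coset_eq1 (X : groupType) (N : normalClosed X) x :
  coset N x = 1 <-> x \in N.
Proof.
rewrite -(morph_1 (coset N)); split=> [/esym/coset_eq|Nx].
  by rewrite invg1 mul1g.
by apply/esym/coset_eq; rewrite invg1 mul1g.
Qed.

Lemma quotient_lift (X Y : groupType) (f : {multiplicative X -> Y})
    (N : normalClosed X) :
  (forall x, x \in N -> f x = 1) ->
  exists g : {multiplicative quotient N -> Y}, forall x, g (coset N x) = f x.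
Proof.
move=> Nf; pose g0 (u : quotient N) := f (repr u).
have g0E x : g0 (coset N x) = f x.
  have /coset_eq/Nf : coset N (repr (coset N x)) = coset N x.
    by rewrite /coset generic_quotient.reprK.
  by rewrite gmulfM morph_V => /mulg1_eq; rewrite invgK.
have g0M : {morph g0 : u v / u * v}.
  elim/quotient_ind=> x; elim/quotient_ind=> y.
  by rewrite -gmulfM !g0E gmulfM.
by have [g gE] := multiplicative_of g0M; exists g => x; rewrite gE g0E.
Qed.

Lemma first_isomorphism (X Y : groupType) (f : {multiplicative X -> Y})
    (N : normalClosed X) :
  surjective f -> (forall x, x \in N <-> f x = 1) ->
  exists g : {multiplicative quotient N -> Y}, bijective g.
Proof.
move=> f_surj Nf; have [|g gE] := @quotient_lift _ _ f N; first by move=> x /Nf.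
have [s sK] := boolp.choice f_surj.
exists g, (fun y => coset N (s y)) => [|y]; last by rewrite gE.
elim/quotient_ind=> x; apply/coset_eq.
by rewrite Nf gmulfM morph_V gE sK mulVg.
Qed.

Lemma iso_closed_sym (C : groupType -> Prop) (X Y : groupType)
    (f : {multiplicative X -> Y}) :
  iso_closed C -> bijective f -> C Y -> C X.
Proof.
move=> isoC [f' fK f'K]; have [g gE] := multiplicative_of (can2_gmulfM fK f'K).
by apply: (isoC _ _ g); exists f => x; rewrite gE.
Qed.

(** * Derived series and solvability *)

Lemma generated_sub (X : groupType) (P : set X) (S : groupClosed X) :
  (forall x, P x -> x \in S) -> {subset generated P <= S}.
Proof. by move=> PS x /asboolP; apply=> y; rewrite inE; apply: PS. Qed.

(** The preimage of a derived subgroup of [Y] is a subgroup of [X], so only the generating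
    commutators need checking. *)
Lemma derived_series_morph (X Y : groupType) (f : {multiplicative X -> Y}) n x :
  x \in derived_series X n -> f x \in derived_series Y n.
Proof.
elim: n x => [|n IHn] x /=.
  by move=> _; apply/asboolP => S; apply; rewrite inE.
have [S SP] : exists S : groupClosed X, forall x, x \in S <->
    f x \in derived_series Y n.+1.
  apply: groupClosed_of => [|y z fy fz|y fy]; first by rewrite morph_1 gpred1.
    by rewrite gmulfM gpredM.
  by rewrite morph_V gpredV.
move=> xX; apply/SP; move: x xX.
apply: generated_sub => _ [y [z [yX zX ->]]]; apply/SP/asboolP => T; apply.
rewrite inE; exists (f y), (f z); split; try exact: IHn.
by rewrite /commg gmulfM morph_V morph_J.
Qed.

Lemma derived_seriesP (X : groupType) n :
  (derived_series X n =i pred1 1) <->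
  forall x, x \in derived_series X n -> x = 1.
Proof.
split=> [X1 x|X1 x]; first by rewrite X1 => /eqP.
by rewrite inE; apply/idP/eqP => [/X1|->]; last exact: gpred1.
Qed.

Lemma solvable_inj (X Y : groupType) (f : {multiplicative X -> Y}) :
  injective f -> solvable_group Y -> solvable_group X.
Proof.
move=> f_inj [n /derived_seriesP Y1]; exists n; apply/derived_seriesP => x.
by move=> /(derived_series_morph f)/Y1; rewrite -(morph_1 f) => /f_inj.
Qed.

(** The [n]-th derived subgroup of [X] lies in the commutative kernel of [f], so one more step
    reaches the trivial group. *)
Lemma solvable_ext (X Y : groupType) (f : {multiplicative X -> Y}) :
  (forall x y, f x = 1 -> f y = 1 -> commute x y) ->
  solvable_group Y -> solvable_group X.
Proof.
move=> kerC [n /derived_seriesP Y1]; exists n.+1; apply/derived_seriesP => /=.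
have [S SP] := trivial_groupClosed X; move=> x xX; apply/SP; move: x xX.
apply: generated_sub => _ [y [z [yX zX ->]]]; apply/SP/eqP/commgP/kerC.
  exact/Y1/derived_series_morph.
exact/Y1/derived_series_morph.
Qed.

Lemma solvable_commutative (X : groupType) :
  (forall x y : X, commute x y) -> solvable_group X.
Proof.
move=> XC; exists 1%N; apply/derived_seriesP => x /=.
have [S SP] := trivial_groupClosed X; move=> xX; apply/SP; move: x xX.
by apply: generated_sub => _ [y [z [_ _ ->]]]; apply/SP/eqP/commgP/XC.
Qed.

(** * Unrestricted wreath products *)

Section Wreath.
Variables P Q : groupType.

Definition wreath : Type := ((Q -> P) * Q)%type.
HB.instance Definition _ := Choice.on wreath.

(** [Q] acts on the base group by right translation of the argument, so the base component of a
    product at [z] collects the values met along the path [z], [z * u.2], and so on. *)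
Definition wreath_mul (u v : wreath) : wreath :=
  (fun z => u.1 z * v.1 (z * u.2), u.2 * v.2).
Definition wreath_one : wreath := (fun=> 1, 1).
Definition wreath_inv (u : wreath) : wreath :=
  (fun z => (u.1 (z * u.2^-1))^-1, u.2^-1).

Fact wreath_mulA : associative wreath_mul.
Proof.
move=> u v w; congr pair; last exact: mulgA.
by apply/funext => z; rewrite /= !mulgA.
Qed.

Fact wreath_1mul : left_id wreath_one wreath_mul.
Proof.
move=> [u x]; congr pair; last exact: mul1g.
by apply/funext => z; rewrite /= mul1g mulg1.
Qed.

Fact wreath_mul1 : right_id wreath_one wreath_mul.
Proof.
move=> [u x]; congr pair; last exact: mulg1.
by apply/funext => z; rewrite /= mulg1.
Qed.

Fact wreath_Vmul : left_inverse wreath_one wreath_inv wreath_mul.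
Proof.
move=> [u x]; congr pair; last exact: mulVg.
by apply/funext => z; rewrite /= mulVg.
Qed.

Fact wreath_mulV : right_inverse wreath_one wreath_inv wreath_mul.
Proof.
move=> [u x]; congr pair; last exact: mulgV.
by apply/funext => z; rewrite /= mulgK mulgV.
Qed.

HB.instance Definition _ := isGroup.Build wreath
  wreath_mulA wreath_1mul wreath_mul1 wreath_Vmul wreath_mulV.

Definition wreath_proj (u : wreath) : Q := u.2.
Fact wreath_projM : {morph wreath_proj : u v / u * v}. Proof. by []. Qed.
HB.instance Definition _ :=
  isMultiplicative.Build wreath Q wreath_proj wreath_projM.

Lemma wreathM (u v : wreath) :
  u * v = (fun z => u.1 z * v.1 (z * u.2), u.2 * v.2).
Proof. by []. Qed.

Lemma wreath1 : 1 = (fun=> 1, 1) :> wreath. Proof. by []. Qed.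

Lemma wreathV (u : wreath) :
  u^-1 = (fun z => (u.1 (z * u.2^-1))^-1, u.2^-1).
Proof. by []. Qed.

Lemma wreath_root_class (C : groupType -> Prop) :
  root_class C -> C P -> C Q -> C wreath.
Proof.
move=> [isoC _ _ gruC] CP CQ.
have [Y YP] : exists Y : normalClosed wreath, forall u, u \in Y <-> u.2 = 1.
  exact: (kernel_normalClosed wreath_proj).
have Yval (y : subgroup Y) : (val y).2 = 1 by apply/YP/valP.
have [ev evE] : exists ev : {multiplicative subgroup Y -> P},
    forall y, ev y = (val y).1 1.
  apply: multiplicative_of => y z.
  by rewrite gmulfM wreathM /= Yval mulg1.
have [Z ZP] : exists Z : normalClosed (subgroup Y),
    forall y, y \in Z <-> ev y = 1.
  exact: kernel_normalClosed.
have [T [TZ CT]] : exists T : normalClosed wreath,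
    (forall x, x \in T -> exists2 z : subgroup Y, z \in Z & val z = x)
    /\ C (quotient T).
  apply: (gruC _ _ Z).
    have [|g g_bij] := @first_isomorphism _ _ ev Z _ ZP.
      move=> p; have [y yE] := subgroup_mem (proj2 (YP (fun=> p, 1)) erefl).
      by exists y; rewrite evE yE.
    exact: iso_closed_sym g_bij CP.
  have [|g g_bij] := @first_isomorphism _ _ wreath_proj Y _ YP.
    by move=> x; exists (fun=> 1, x).
  exact: iso_closed_sym g_bij CQ.
have T1 u : u \in T -> u = 1.
  move=> uT; have [y _ yu] := TZ _ uT.
  case: u uT yu => u x uT yu.
  have := Yval y; rewrite yu /= => x1; subst x.
  congr pair; apply/funext => q /=.
  (* The conjugate of [u] by [c] has at 1 the value of [u] at [q]; it lies in [T], so this value is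
     1. *)
  pose c : wreath := (fun=> 1, q^-1).
  have := TZ _ (gpredJr _ c uT) => -[z /ZP]; rewrite evE => zP zE.
  move: zP; rewrite zE /conjg !wreathM wreathV /=.
  by rewrite invgK invg1 !mul1g mulg1 => ->.
(* As [T] is trivial, it is the kernel of the identity, which identifies the quotient by [T] with
   the wreath product. *)
pose f : {multiplicative wreath -> wreath} := idfun.
have [||g g_bij] := @first_isomorphism _ _ f T.
- by move=> u; exists u.
- by move=> u; split=> [/T1|u1] //; rewrite (u1 : u = 1) gpred1.
exact: isoC g_bij CT.
Qed.

Lemma wreath_solvable :
  (forall x y : P, commute x y) -> solvable_group Q -> solvable_group wreath.
Proof.
move=> PC; apply: (@solvable_ext _ _ wreath_proj) => -[u x] [v y].
rewrite /wreath_proj /= => -> ->; rewrite /commute !wreathM /=.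
by congr pair; apply/funext => z; rewrite /= mulg1; apply: PC.
Qed.

End Wreath.

(** * Cocycles and homomorphisms to wreath products *)

Section Cocycle.
Variables (G P Q : groupType) (al : {multiplicative G -> Q}).

Definition cocycle (f : G -> Q -> P) :=
  forall a b z, f (a * b) z = f a z * f b (z * al a).

Lemma cocycle_morph (f : G -> Q -> P) : cocycle f ->
  exists g : {multiplicative G -> wreath P Q}, forall a, g a = (f a, al a).
Proof.
move=> fM; apply: multiplicative_of => a b; rewrite wreathM /= gmulfM.
by congr pair; apply/funext => z; apply: fM.
Qed.

(** In the wreath product this is conjugation of the homomorphism by the base element [(m, 1)]. *)
Lemma cocycle_twist (f : G -> Q -> P) (m : Q -> P) : cocycle f ->
  cocycle (fun a z => (m z)^-1 * f a z * m (z * al a)).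
Proof. by move=> fM a b z; rewrite fM gmulfM !mulgA mulgK. Qed.

(** A point is fixed in each left coset of the image of [al], and [al (tau z)] carries the point of
    the coset of [z] to [z]. As [z] and [z * al a] share that point, the two sides agree, but only
    after applying [al]. *)
Lemma transversal : exists tau : Q -> G,
  forall z a, al (tau (z * al a)) = al (tau z) * al a.
Proof.
pose co (z : Q) : pred Q := fun y => `[< exists a, z = y * al a >].
have coP z : exists y, co z y.
  by exists z; apply/asboolP; exists 1; rewrite morph_1 mulg1.
have co_eq z a : co (z * al a) =1 co z.
  move=> y; apply/asboolP/asboolP => -[b].
    move=> /(congr1 ( *%g^~ (al a^-1))); rewrite -mulgA -gmulfM mulgV morph_1.
    by rewrite mulg1 -mulgA -gmulfM; exists (b / a).
  by move=> ->; exists (b * a); rewrite gmulfM mulgA.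
pose r z := xchoose (coP z).
have /boolp.choice[tau tauE] : forall z, exists a, z = r z * al a.
  by move=> z; apply/asboolP/(xchooseP (coP z)).
exists tau => z a; apply: (@mulgI _ (r z)).
have rE : r (z * al a) = r z by apply: eq_xchoose; apply: co_eq.
by rewrite -[in LHS]rE -tauE mulgA -tauE.
Qed.

(* [H^1] of a group with coefficients in a coinduced module vanishes. *)
Lemma cocycle_coboundary (d : G -> Q -> P) : cocycle d ->
  (forall a z, al a = 1 -> d a z = 1) ->
  exists m : Q -> P, forall a z, d a z = (m z)^-1 * m (z * al a).
Proof.
move=> dM d1; have [tau tauM] := transversal.
have d_ker a b z : al a = al b -> d a z = d b z.
  move=> ab; rewrite -[a](mulVKg b) dM (d1 (b^-1 * a)) ?mulg1 //.
  by rewrite gmulfM morph_V ab mulVg.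
(* [r z] is constant on left cosets of the image of [al] and [r z * al (tau z) = z], so the function
   chosen next is the value of [d] on the step from [r z] to [z]. *)
pose r z := z * (al (tau z))^-1.
exists (fun z => d (tau z) (r z)) => a z.
have -> : r (z * al a) = r z by rewrite /r tauM invgM mulgA mulgK.
rewrite (d_ker (tau (z * al a)) (tau z * a)) ?gmulfM ?tauM //.
by rewrite dM mulKg /r mulgVK.
Qed.

(* Kaloujnine-Krasner embedding of an extension of [al G] by a quotient of the
   kernel of [al]; centrality makes the base component of the kernel constant. *)
Lemma cocycle_central (p : G -> P) :
  (forall a b, al a = 1 -> al b = 1 -> p (a * b) = p a * p b) ->
  (forall a b, al a = 1 -> p (a ^ b) = p a) ->
  exists2 f, cocycle f & forall a z, al a = 1 -> f a z = p a.
Proof.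
move=> pM pJ; have [tau tauM] := transversal.
(* The argument of [p] is a Schreier factor: the choice of [tau] puts it in the kernel of [al], and
   for [a] in that kernel it is a conjugate of [a]. *)
exists (fun a z => p (tau z * a * (tau (z * al a))^-1)) => [a b z|a z a1].
  rewrite -pM; last 2 first.
  - by rewrite !gmulfM morph_V !tauM mulgV.
  - by rewrite !gmulfM morph_V !tauM mulgV.
  by rewrite !mulgA gmulfM mulgA mulgVK.
rewrite a1 mulg1 -[in RHS](pJ a (tau z)^-1) //.
by rewrite /conjg invgK mulgA.
Qed.

End Cocycle.

(** Homomorphisms to wreath products need not be onto. Restricting to the image makes them so, and
    subgroups inherit both solvability and membership in [C]. *)
Lemma image_factorization (C : groupType -> Prop) (X Y : groupType)
    (f : {multiplicative X -> Y}) :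
  root_class C -> solvable_in C Y ->
  exists (Q : groupType) (g : {multiplicative X -> Q})
    (i : {multiplicative Q -> Y}),
    [/\ solvable_in C Q, surjective g & forall x, i (g x) = f x].
Proof.
move=> rootC [CY solY].
have [S SP] : exists S : groupClosed Y, forall y, y \in S <-> exists x, f x = y.
  apply: groupClosed_of => [|_ _ [x <-] [x' <-]|_ [x <-]].
  - by exists 1; rewrite morph_1.
  - by exists (x * x'); rewrite gmulfM.
  by exists x^-1; rewrite morph_V.
have /boolp.choice[g0 g0E] : forall x, exists s : subgroup S, val s = f x.
  by move=> x; apply/subgroup_mem/SP; exists x.
have g0M : {morph g0 : x y / x * y}.
  by move=> x y; apply: val_inj; rewrite valM !g0E gmulfM.
have [g gE] := multiplicative_of g0M.
exists (subgroup S), g, (val : {multiplicative subgroup S -> Y}); split.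
- split; first exact: root_class_sub.
  exact: (@solvable_inj _ _ (val : {multiplicative subgroup S -> Y}) val_inj).
- move=> s; have /SP[x fx] := valP s; exists x; apply: val_inj.
  by rewrite gE g0E.
by move=> x; rewrite gE; apply: g0E.
Qed.

(** * Universal property and reduced words of the amalgamated product *)

Section Amalgam.
Variables (A B : groupType) (H : groupClosed A) (K : groupClosed B).
Variable phi : {multiplicative subgroup H -> subgroup K}.

Definition amalgam_letter (s : A + B) : amalgam phi :=
  match s with inl a => amalgam_inl phi a | inr b => amalgam_inr phi b end.

Definition amalgam_word (w : word A B) : amalgam phi :=
  coset (amalgam_kernel phi) (word_class w).

Lemma amalgam_word_cons s w :
  amalgam_word (s :: w) = amalgam_letter s * amalgam_word w.
Proof.
by rewrite /amalgam_word -cat1s word_classM; case: s => x; apply: gmulfM.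
Qed.

Lemma amalgam_word_cat v w :
  amalgam_word (v ++ w) = amalgam_word v * amalgam_word w.
Proof. by rewrite /amalgam_word word_classM; apply: gmulfM. Qed.

Lemma amalgam_wordP (g : amalgam phi) : exists w, g = amalgam_word w.
Proof.
by elim/quotient_ind: g; elim/free_product_ind=> w; exists w.
Qed.

Lemma amalgam_inl_inr h :
  amalgam_inl phi (val h) = amalgam_inr phi (val (phi h)).
Proof.
apply/esym/coset_eq; apply/asboolP => S PS.
(* With [k] the image of [h], the relator is [h k^-1] while the coset criterion asks for [k^-1 h];
   conjugation by [k] turns one into the other. *)
have := PS (free_inl B (val h) * (free_inr A (val (phi h)))^-1).
rewrite inE => /(_ _)/(gpredJr _ (free_inr A (val (phi h)))).
rewrite /conjg mulgVK; apply.
by exists h.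
Qed.

(** Letterwise evaluation respects the congruence on words, and the kernel of the resulting
    homomorphism is a normal subgroup containing the relators. *)
Lemma amalgam_lift (Q : groupType)
    (al : {multiplicative A -> Q}) (be : {multiplicative B -> Q}) :
  (forall h, al (val h) = be (val (phi h))) ->
  exists f : {multiplicative amalgam phi -> Q},
    (forall a, f (amalgam_inl phi a) = al a) /\
    (forall b, f (amalgam_inr phi b) = be b).
Proof.
move=> compat.
pose letter (s : A + B) := match s with inl a => al a | inr b => be b end.
pose ev := foldr (fun s q => letter s * q) 1.
have ev_cat v w : ev (v ++ w) = ev v * ev w.
  by elim: v => [|s v IHv] /=; rewrite ?mul1g // IHv mulgA.
have ev_eq v w : word_eq v w -> ev v = ev w.
  elim=> //= {v w} => [v w u _ -> _ ->|u v w t _ uv _ wt||||] //.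
  - by rewrite !ev_cat uv wt.
  - by rewrite morph_1 mulg1.
  - by rewrite morph_1 mulg1.
  - by move=> a a'; rewrite gmulfM !mulg1.
  - by move=> b b'; rewrite gmulfM !mulg1.
pose g0 (u : free_product A B) := ev (repr u).
have g0E w : g0 (word_class w) = ev w by apply/ev_eq/repr_word_class.
have g0M : {morph g0 : u v / u * v}.
  elim/free_product_ind=> v; elim/free_product_ind=> w.
  by rewrite -[_ * _]word_classM !g0E ev_cat.
have [g gE] := multiplicative_of g0M.
have gl a : g (free_inl B a) = al a by rewrite gE g0E /= mulg1.
have gr b : g (free_inr A b) = be b by rewrite gE g0E /= mulg1.
have [S SP] := kernel_normalClosed g.
have [|f fE] := @quotient_lift _ _ g (amalgam_kernel phi).
  move=> x /asboolP/(_ S) xS; apply/SP/xS => _ /set_mem[h _ <-]; apply/SP.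
  by rewrite gmulfM morph_V gl gr compat mulgV.
by exists f; split=> x; rewrite /= fE.
Qed.

Definition in_amalgamated (s : A + B) : bool :=
  match s with inl a => a \in H | inr b => b \in K end.

Definition same_factor (s t : A + B) : bool :=
  match s, t with inl _, inl _ | inr _, inr _ => true | _, _ => false end.

(** A word sorted for this relation is reduced once it has two letters; a single letter is
    unconstrained. *)
Definition reduced_pair (s t : A + B) : bool :=
  [&& ~~ same_factor s t, ~~ in_amalgamated s & ~~ in_amalgamated t].

Lemma not_sorted_split (T : Type) (e : rel T) w : ~~ sorted e w ->
  exists u s t v, w = u ++ [:: s, t & v] /\ ~~ e s t.
Proof.
elim: w => // s [|t w] IHw //=; rewrite negb_and => /orP[nst|/IHw].
  by exists [::], s, t, w.
by move=> [u [s' [t' [v [-> nst]]]]]; exists (s :: u), s', t', v.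
Qed.

(** A letter from an amalgamated subgroup can be read in the other factor, through [phi] or its
    inverse, and then multiplied with its neighbour. *)
Lemma merge_pair (s t : A + B) : bijective phi -> ~~ reduced_pair s t ->
  exists r, amalgam_letter s * amalgam_letter t = amalgam_letter r.
Proof.
move=> [psi _ psiK]; have toA b : b \in K ->
    exists a, amalgam_inl phi a = amalgam_inr phi b.
  move=> /subgroup_mem[k <-]; exists (val (psi k)).
  by rewrite amalgam_inl_inr psiK.
have toB a : a \in H -> exists b, amalgam_inr phi b = amalgam_inl phi a.
  by move=> /subgroup_mem[h <-]; exists (val (phi h)); rewrite amalgam_inl_inr.
case: s t => [a|b] [a'|b'] /=; rewrite /reduced_pair /=.
- by exists (inl (a * a')); rewrite -gmulfM.
- rewrite negb_and !negbK => /orP[/toB[b <-]|/toA[a' <-]].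
    by exists (inr (b * b')); rewrite -gmulfM.
  by exists (inl (a * a')); rewrite -gmulfM.
- rewrite negb_and !negbK => /orP[/toA[a <-]|/toB[b' <-]].
    by exists (inl (a * a')); rewrite -gmulfM.
  by exists (inr (b * b')); rewrite -gmulfM.
by exists (inr (b * b')); rewrite -gmulfM.
Qed.

(** In a word of minimal length for [g], no adjacent pair can be merged. *)
Lemma reduced_form (g : amalgam phi) : bijective phi ->
  (exists s, g = amalgam_letter s) \/
  exists s t w, sorted reduced_pair [:: s, t & w] /\
    g = amalgam_word [:: s, t & w].
Proof.
move=> phi_bij.
have ex_w : exists n, `[< exists w, size w = n /\ g = amalgam_word w >].
  by have [w ->] := amalgam_wordP g; exists (size w); apply/asboolP; exists w.
case: (ex_minnP ex_w) => _ /asboolP[w [<- ->]] w_min.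
case: w w_min => [|s [|t w]] w_min.
- by left; exists (inl 1); rewrite /= morph_1.
- by left; exists s; rewrite amalgam_word_cons [amalgam_word [::]]morph_1 mulg1.
right; exists s, t, w; split=> //; apply/negPn/negP => /not_sorted_split.
move=> [u [s' [t' [v [w_def nst]]]]]; have [r rE] := merge_pair phi_bij nst.
have := w_min (size (u ++ r :: v)); rewrite w_def !size_cat /= => /(_ _)/wrap[].
  apply/asboolP; exists (u ++ r :: v); split; first by rewrite size_cat.
  by rewrite !amalgam_word_cat !amalgam_word_cons -rE -mulgA.
by rewrite leq_add2l ltnn.
Qed.

End Amalgam.

(** The double centralizer of a nontrivial [x] contains [x], and it is commutative because its
    elements commute with [x]. *)
Lemma commutative_root_class (C : groupType -> Prop) :
  root_class C -> nontrivial_class C ->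
  exists P : groupType,
    [/\ C P, forall x y : P, commute x y & exists x : P, x <> 1].
Proof.
move=> rootC [X CX [x x1]].
have [S SP] : exists S : groupClosed X, forall y, y \in S <->
    forall z, commute z x -> commute z y.
  apply: groupClosed_of => [z _|y y' yC y'C z zx|y yC z zx].
  - exact: commute1.
  - by apply: commuteM; [apply: yC | apply: y'C].
  by apply: commuteV; apply: yC.
exists (subgroup S); split; first exact: root_class_sub.
  move=> y z; apply: val_inj; rewrite !valM.
  have /SP zC := valP z; have /SP yC := valP y.
  by apply: zC; apply/commute_sym/yC; apply: commute_refl.
have [|s sE] := @subgroup_mem _ S x; first by apply/SP.
by exists s => s1; apply: x1; rewrite -sE s1.
Qed.

(** * Compatible pairs of homomorphisms and their refinement by a central factor *)

Section Compatible.
Variables (A B : groupType) (H : groupClosed A) (K : groupClosed B).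
Variable phi : {multiplicative subgroup H -> subgroup K}.

Definition compatible (Q : groupType) (al : {multiplicative A -> Q})
    (be : {multiplicative B -> Q}) :=
  forall h, al (val h) = be (val (phi h)).

Section Twist.
Variables (P Q : groupType).
Variables (al : {multiplicative A -> Q}) (be : {multiplicative B -> Q}).
Hypothesis compat : compatible al be.

Lemma cocycle_compatible (f : A -> Q -> P) (g : B -> Q -> P) :
  cocycle al f -> cocycle be g ->
  (forall h z, f (val h) z = g (val (phi h)) z) ->
  exists (al' : {multiplicative A -> wreath P Q})
    (be' : {multiplicative B -> wreath P Q}),
    [/\ compatible al' be', forall a, al' a = (f a, al a)
      & forall b, be' b = (g b, be b)].
Proof.
move=> fM gM fg; have [al' al'E] := cocycle_morph fM.
have [be' be'E] := cocycle_morph gM; exists al', be'; split=> // h.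
by rewrite al'E be'E compat; congr pair; apply/funext => z; apply: fg.
Qed.

Lemma compatible_refine (pA : A -> P) (pB : B -> P) :
  (forall x y : P, commute x y) ->
  (forall a b, al a = 1 -> al b = 1 -> pA (a * b) = pA a * pA b) ->
  (forall a b, al a = 1 -> pA (a ^ b) = pA a) ->
  (forall a b, be a = 1 -> be b = 1 -> pB (a * b) = pB a * pB b) ->
  (forall a b, be a = 1 -> pB (a ^ b) = pB a) ->
  (forall h, al (val h) = 1 -> pA (val h) = pB (val (phi h))) ->
  exists (al' : {multiplicative A -> wreath P Q})
    (be' : {multiplicative B -> wreath P Q}),
    [/\ compatible al' be', forall a, al' a = 1 <-> al a = 1 /\ pA a = 1
      & forall b, be' b = 1 <-> be b = 1 /\ pB b = 1].
Proof.
move=> PC pAM pAJ pBM pBJ pAB.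
have [f fM f_ker] := cocycle_central pAM pAJ.
have [g gM g_ker] := cocycle_central pBM pBJ.
have alHM : {morph (fun h : subgroup H => al (val h)) : x y / x * y}.
  by move=> x y; rewrite valM gmulfM.
have [alH alHE] := multiplicative_of alHM.
(* Commutativity of [P] makes this quotient of two cocycles a cocycle on [H]; it is trivial on the
   kernel because [pA] and [pB] agree there. *)
pose d (h : subgroup H) z := (g (val (phi h)) z)^-1 * f (val h) z.
have [|h z h1|m mE] := @cocycle_coboundary _ _ _ alH d.
- move=> h k z; rewrite /d gmulfM !valM fM gM alHE -compat invgM !mulgA.
  set x := f (val h) z; set x' := (g (val (phi h)) z)^-1.
  set y := (g _ _)^-1; by rewrite -(mulgA y) (PC y).
- rewrite alHE in h1; rewrite /d f_ker // g_ker -?compat // pAB //.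
  by rewrite mulVg.
have gmM := cocycle_twist m gM.
have [|al' [be' [compat' al'E be'E]]] := cocycle_compatible fM gmM.
  move=> h z; rewrite -compat -alHE -mulgA (PC (g _ _)) mulgA.
  by rewrite -mE /d (PC _ (f _ _)) mulgVK.
exists al', be'; split=> // [a|b]; rewrite ?al'E ?be'E wreath1.
  split=> [[fa a1]|[a1 pa1]]; first by rewrite -(f_ker a 1) ?fa.
  by congr pair => //; apply/funext => z; rewrite f_ker.
(* On the kernel of [be] the twist is conjugation by [m z], which changes nothing in the commutative
   group [P]. *)
have twist z : be b = 1 -> (m z)^-1 * g b z * m (z * be b) = pB b.
  by move=> b1; rewrite b1 mulg1 (PC _ (g b z)) mulgVK g_ker.
split=> [[/funeqP gb b1]|[b1 pb1]]; first by rewrite -(twist 1) ?gb.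
by congr pair => //; apply/funext => z; rewrite twist.
Qed.

End Twist.

Section Central.
Variable C : groupType -> Prop.
Hypotheses (rootC : root_class C) (quotC : quotient_closed C).
Hypotheses (CA : C A) (CB : C B).
Variables (A1 A2 : normalClosed A) (B1 B2 : normalClosed B).
Hypothesis A2C : forall x, x \in A2 ->
  forall u : quotient A1, commute (coset A1 x) u.
Hypothesis B2C : forall x, x \in B2 ->
  forall u : quotient B1, commute (coset B1 x) u.
Hypothesis phi1 : forall h, (val h \in A1) <-> (val (phi h) \in B1).
Hypothesis phi2 : forall h, (val h \in A2) <-> (val (phi h) \in B2).

(** The whole centre of the quotient by [N] is commutative and in [C] at once. Centrality of [A2]
    and [B2] modulo [A1] and [B1] makes [N] a normal subgroup and sends both into that centre. *)
Lemma central_factor_amalgam :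
  exists (P : groupType) (pA : A -> P) (pB : B -> P),
  [/\ C P, forall x y : P, commute x y,
     [/\ {in A2 &, {morph pA : x y / x * y}},
         forall a b, a \in A2 -> pA (a ^ b) = pA a
       & forall a, a \in A2 -> pA a = 1 <-> a \in A1],
     [/\ {in B2 &, {morph pB : x y / x * y}},
         forall a b, a \in B2 -> pB (a ^ b) = pB a
       & forall b, b \in B2 -> pB b = 1 <-> b \in B1]
   & forall h, val h \in A2 -> pA (val h) = pB (val (phi h))].
Proof.
pose cA : {multiplicative A -> quotient A1} := coset A1.
pose cB : {multiplicative B -> quotient B1} := coset B1.
pose X : groupType := (quotient A1 * quotient B1)%type.
have pairM (x y : X) : x * y = (x.1 * y.1, x.2 * y.2) by [].
have pairV (x : X) : x^-1 = (x.1^-1, x.2^-1) by [].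
have pairJ (x y : X) : x ^ y = (x.1 ^ y.1, x.2 ^ y.2) by [].
pose inN (u : X) := exists h : subgroup H,
  [/\ val h \in A2, u.1 = cA (val h) & u.2 = (cB (val (phi h)))^-1].
have [N NP] : exists N : normalClosed X, forall u, u \in N <-> inN u.
  apply: normalClosed_of.
  - exists 1; rewrite (morph_1 phi) !val1 (morph_1 cA) (morph_1 cB) invg1.
    by split; first exact: gpred1.
  - move=> u v [h [hA u1 u2]] [k [kA v1 v2]]; exists (h * k).
    rewrite valM [phi _]gmulfM valM pairM u1 u2 v1 v2 !gmulfM invgM.
    split=> //; first exact: gpredM.
    by rewrite -!(morph_V cB); apply: B2C; rewrite gpredV; apply/phi2.
  - move=> u [h [hA u1 u2]]; exists h^-1.
    rewrite (morph_V phi) !subgroup_valV gpredV pairV u1 u2.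
    by rewrite (morph_V cA) (morph_V cB).
  move=> u v [h [hA u1 u2]]; exists h; rewrite pairJ u1 u2; split=> //.
    by apply/conjg_fixP/commgP; apply: A2C.
  by rewrite conjVg; congr _^-1; apply/conjg_fixP/commgP; apply/B2C/phi2.
have N_inN u v : inN (u^-1 * v) -> coset N u = coset N v.
  by move=> uv; apply/coset_eq/NP.
pose P' : groupType := quotient N.
have [Z ZP] : exists Z : groupClosed P', forall x, x \in Z <->
    forall y, commute y x.
  apply: groupClosed_of => [y|x x' xC x'C y|x xC y]; first exact: commute1.
    exact: commuteM.
  exact: commuteV.
pose P : groupType := subgroup Z.
(* The conditional form yields total functions [pA] and [pB], whose values outside [A2] and [B2]
   remain unspecified. *)
have liftP x (D : Prop) : (D -> forall y, commute y x) ->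
    exists p : P, D -> val p = x.
  move=> xC; have [d|nd] := pselect D; last by exists 1.
  by have [p pE] := subgroup_mem (proj2 (ZP x) (xC d)); exists p.
have /boolp.choice[pA pAE] : forall a, exists p : P, a \in A2 ->
    val p = coset N (cA a, 1).
  move=> a; apply: liftP => aA; elim/quotient_ind=> u.
  apply: gmulf_commute; rewrite /commute !pairM mulg1 mul1g.
  by congr pair; apply/esym/A2C.
have /boolp.choice[pB pBE] : forall b, exists p : P, b \in B2 ->
    val p = coset N (1, cB b).
  move=> b; apply: liftP => bB; elim/quotient_ind=> u.
  apply: gmulf_commute; rewrite /commute !pairM mulg1 mul1g.
  by congr pair; apply/esym/B2C.
exists P, pA, pB; split.
- apply: root_class_sub => //; apply: (quotC N).
  by apply: root_class_prod => //; apply: quotC.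
- by move=> x y; apply: val_inj; rewrite !valM; have /ZP := valP y; apply.
- split=> [a a' aA a'A|a b aA|a aA].
  + apply: val_inj; rewrite valM !pAE ?gpredM // -gmulfM pairM.
    by rewrite mulg1 gmulfM.
  + apply: val_inj; rewrite !pAE ?gpredJr //; congr (coset N (pair _ _)).
    by rewrite morph_J; apply/conjg_fixP/commgP/A2C.
  split=> [/(congr1 val)|/coset_eq1 a1].
    (* If [(cA a, 1)] lies in [N] through [h], the second coordinate puts [phi h] in [B1], hence [h]
       in [A1], and the first coordinate then puts [a] in [A1]. *)
    rewrite val1 pAE // => /coset_eq1/NP[h [hA /= ha /(congr1 inv)]].
    rewrite invgK invg1 => /esym/coset_eq1/phi1 h1.
    by apply/coset_eq1; rewrite -/cA [LHS]ha; apply/coset_eq1.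
  by apply: val_inj; rewrite val1 pAE // [cA a]a1 -[RHS](morph_1 (coset N)).
- split=> [b b' bB b'B|b a bB|b bB].
  + apply: val_inj; rewrite valM !pBE ?gpredM // -gmulfM pairM.
    by rewrite mulg1 gmulfM.
  + apply: val_inj; rewrite !pBE ?gpredJr //; congr (coset N (pair _ _)).
    by rewrite morph_J; apply/conjg_fixP/commgP/B2C.
  split=> [/(congr1 val)|/coset_eq1 b1].
    rewrite val1 pBE // => /coset_eq1/NP[h [hA /= /esym/coset_eq1 h1 hb]].
    apply/coset_eq1; rewrite -/cB [LHS]hb; apply/eqP; rewrite invg_eq1.
    by apply/eqP/coset_eq1/phi1.
  by apply: val_inj; rewrite val1 pBE // [cB b]b1 -[RHS](morph_1 (coset N)).
move=> h hA; apply: val_inj; rewrite pAE // pBE; last exact/phi2.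
(* The inverse of [(cA h, 1)] times [(1, cB (phi h))] is the element of [N] attached to [h^-1]. *)
apply: N_inN; exists h^-1; rewrite (morph_V phi) !subgroup_valV gpredV.
by rewrite (morph_V cA) (morph_V cB) invgK pairM pairV mulg1 invg1 mul1g.
Qed.

End Central.
End Compatible.

(** * Embedding of the factors and separation of reduced words *)

Section Separation.
Variable C : groupType -> Prop.
Hypothesis rootC : root_class C.
Variables (A B : groupType) (H : groupClosed A) (K : groupClosed B).
Variable phi : {multiplicative subgroup H -> subgroup K}.

Lemma compatible_central_series n (As : nat -> normalClosed A)
    (Bs : nat -> normalClosed B) :
  quotient_closed C -> C A -> C B ->
  central_series n As -> central_series n Bs ->
  (forall i h, i <= n -> val h \in As i <-> val (phi h) \in Bs i) ->
  exists (Q : groupType) (al : {multiplicative A -> Q})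
    (be : {multiplicative B -> Q}),
    [/\ solvable_in C Q, compatible phi al be, injective al & injective be].
Proof.
move=> quotC CA CB [A0 An AsS AsC] [B0 Bn BsS BsC] AB.
(* Descending induction on [i], run as an induction on [k = n - i]; at [i = 0] trivial kernels give
   injectivity. *)
suff /(_ n 0%N (addn0 n)) : forall k i, k + i = n ->
    exists (Q : groupType) (al : {multiplicative A -> Q})
      (be : {multiplicative B -> Q}),
      [/\ solvable_in C Q, compatible phi al be,
        forall a, al a = 1 <-> a \in As i & forall b, be b = 1 <-> b \in Bs i].
  move=> [Q [al [be [solQ compat alE beE]]]]; exists Q, al, be; split=> //.
    by apply: morph_inj => a /alE; rewrite A0 => /eqP.
  by apply: morph_inj => b /beE; rewrite B0 => /eqP.
elim=> [|k IHk] i; rewrite ?add0n ?addSnnS => i_n.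
  (* At [i = n] the kernels are everything; the trivial group is taken inside [A] so that it lies in
     [C]. *)
  rewrite i_n; have [S SP] := trivial_groupClosed A.
  have [al alE] : exists al : {multiplicative A -> subgroup S}, al =1 fun=> 1.
    by apply: multiplicative_of => a a'; rewrite mulg1.
  have [be beE] : exists be : {multiplicative B -> subgroup S}, be =1 fun=> 1.
    by apply: multiplicative_of => b b'; rewrite mulg1.
  exists (subgroup S), al, be; split=> [|h|a|b].
  - split; first exact: root_class_sub.
    apply: solvable_commutative => x y; apply: val_inj; rewrite !valM.
    by have /SP -> := valP x; rewrite mulg1 mul1g.
  - by rewrite alE beE.
  - by rewrite alE An.
  by rewrite beE Bn.
have [Q [al [be [[CQ solQ] compat alE beE]]]] := IHk _ i_n.
have i_lt : i < n by rewrite -i_n addnS ltnS leq_addl.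
have [P [pA [pB [CP PC [pAM pAJ pA1] [pBM pBJ pB1] pAB]]]] :=
  central_factor_amalgam rootC quotC CA CB (AsC _ i_lt) (BsC _ i_lt)
    (fun h => AB i h (ltnW i_lt)) (fun h => AB i.+1 h i_lt).
have [|||||al' [be' [compat' al'E be'E]]] :=
    @compatible_refine _ _ _ _ phi P Q al be compat pA pB PC.
- by move=> a b /alE aA /alE bA; apply: pAM.
- by move=> a b /alE aA; apply: pAJ.
- by move=> a b /beE aB /beE bB; apply: pBM.
- by move=> a b /beE aB; apply: pBJ.
- by move=> h /alE hA; apply: pAB.
exists (wreath P Q), al', be'; split=> // [|a|b].
- by split; [apply: wreath_root_class | apply: wreath_solvable].
- rewrite al'E; split=> [[/alE aA /pA1]|aA]; first exact.
  have aA' := AsS _ i_lt _ aA.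
  by split; [apply/alE | apply/pA1].
rewrite be'E; split=> [[/beE bB /pB1]|bB]; first exact.
have bB' := BsS _ i_lt _ bB.
by split; [apply/beE | apply/pB1].
Qed.

Section Evaluation.
Variables (Q : groupType).
Variables (al : {multiplicative A -> Q}) (be : {multiplicative B -> Q}).

Definition letter_eval (s : A + B) : Q :=
  match s with inl a => al a | inr b => be b end.

Definition word_eval (w : word A B) : Q :=
  foldr (fun s q => letter_eval s * q) 1 w.

Lemma letter_eval_amalgamated (s : A + B) (h : subgroup H) :
  compatible phi al be ->
  injective al -> injective be -> letter_eval s = al (val h) ->
  in_amalgamated H K s.
Proof.
move=> compat al_inj be_inj; case: s => [a|b] /=.
  by move/al_inj->; apply: valP.
by rewrite compat => /be_inj->; apply: valP.
Qed.

End Evaluation.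

(** The induction removes the first letter and must control all nonempty prefixes, since those of
    the tail decide whether the path returns to the coset of [s]. Injectivity is carried along for
    prefixes of one letter. *)
Lemma separate_prefixes (Q0 : groupType) (al0 : {multiplicative A -> Q0})
    (be0 : {multiplicative B -> Q0}) :
  nontrivial_class C -> solvable_in C Q0 -> compatible phi al0 be0 ->
  injective al0 -> injective be0 ->
  forall w s, path (reduced_pair H K) s w -> ~~ in_amalgamated H K s ->
  exists (Q : groupType) (al : {multiplicative A -> Q})
    (be : {multiplicative B -> Q}),
    [/\ solvable_in C Q, compatible phi al be, injective al, injective be &
      forall k (h : subgroup H), 0 < k ->
        word_eval al be (take k (s :: w)) <> al (val h)].
Proof.
move=> nontrivC solQ0 compat0 al0_inj be0_inj; elim=> [|t w IHw] s /=.
  move=> _ sH; exists Q0, al0, be0; split=> // -[|k] h //= _.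
  rewrite mulg1 => /(letter_eval_amalgamated compat0 al0_inj be0_inj).
  by rewrite (negPf sH).
move=> /andP[/and3P[st _ tH] tw] sH.
have [Q [al [be [[CQ solQ] compat al_inj be_inj sep]]]] := IHw _ tw tH.
have [S [CS SC [sg sg1]]] := commutative_root_class rootC nontrivC.
pose e := letter_eval al be s.
pose onE z := exists h : subgroup H, z = e * al (val h).
pose m z := if `[< onE z >] then sg else 1.
have m_onE z : onE z -> m z = sg by move=> ?; rewrite /m asboolT.
have m_offE z : ~ onE z -> m z = 1 by move=> ?; rewrite /m asboolF.
(* This invariance makes the twisted cocycle on [B] trivial on the image of [phi], in agreement with
   the trivial cocycle on [A]. *)
have mH z (h : subgroup H) : m (z * al (val h)) = m z.
  have zh : onE (z * al (val h)) <-> onE z.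
    split=> -[k]; last by move=> ->; exists (k * h); rewrite valM gmulfM mulgA.
    move=> zE; exists (k / h); rewrite valM subgroup_valV gmulfM morph_V.
    by rewrite mulgA -zE mulgK.
  have [/[dup] /m_onE -> /zh/m_onE -> //|] := pselect (onE z).
  by move=> /[dup] /m_offE -> nz; apply: m_offE => /zh.
have fM : cocycle al (fun _ _ => 1 : S) by move=> a b z; rewrite mulg1.
have gM : cocycle be (fun _ _ => 1 : S) by move=> a b z; rewrite mulg1.
have {}gM := cocycle_twist m gM.
have [|al' [be' [compat' al'E be'E]]] := cocycle_compatible compat fM gM.
  by move=> h z; rewrite mulg1 -compat mH mulVg.
have ev2 v : (word_eval al' be' v).2 = word_eval al be v.
  elim: v => //= r v <-.
  by case: r => x /=; rewrite ?al'E ?be'E.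
(* A path from [z] that avoids the coset of [e] meets only the value 1 of [m]. *)
have ev1 v z : (forall k, ~ onE (z * word_eval al be (take k v))) ->
    (word_eval al' be' v).1 z = 1.
  elim: v z => //= r v IHv z off; rewrite IHv ?mulg1 => [|k].
    case: r off => x off /=; rewrite ?al'E ?be'E //= mulg1.
    have := off 0%N; have := off 1%N; rewrite /= take0 /= !mulg1.
    by move=> /m_offE-> /m_offE->; rewrite mulVg.
  have := off k.+1; rewrite /= mulgA.
  by case: (r) => x /=; rewrite ?al'E ?be'E.
have al'_inj : injective al' by move=> x y; rewrite !al'E => -[/al_inj].
have be'_inj : injective be' by move=> x y; rewrite !be'E => -[_ /be_inj].
exists (wreath S Q), al', be'; split=> //.
  by split; [apply: wreath_root_class | apply: wreath_solvable].
move=> [|[|k]] h //= _.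
  rewrite mulg1.
  move=> /(letter_eval_amalgamated compat' al'_inj be'_inj).
  by rewrite (negPf sH).
(* The image of [H] has trivial base component, so a nontrivial one at 1 suffices for a
   contradiction. *)
rewrite al'E => /(congr1 (fun u : wreath S Q => u.1 1)).
(* Cancelling [e], a return to the coset would place the prefix of length [j.+1] of [t :: w] in the
   image of [H]. *)
have off_t j : ~ onE (e * letter_eval al be t * word_eval al be (take j w)).
  by move=> [h']; rewrite -mulgA => /mulgI; apply: (sep j.+1).
have off_1 : ~ onE 1.
  move=> [h' /esym/mulg1_eq eh]; move: sH; rewrite -[in_amalgamated _ _ _]negbK.
  rewrite (@letter_eval_amalgamated _ al be s h'^-1) //.
  by rewrite subgroup_valV morph_V; apply: invg_inj; rewrite invgK.
have on_e : onE e by exists 1; rewrite val1 morph_1 mulg1.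
have rest : (word_eval al' be' (take k w)).1 (e * letter_eval al be t) = 1.
  (* For [j] beyond [k] the truncation is [take k w] itself, already covered by [off_t]. *)
  apply: ev1 => j; have [jk|kj] := leqP j k; first by rewrite take_takel.
  rewrite take_oversize // size_take.
  exact: leq_trans (geq_minl _ _) (ltnW kj).
have off_et : m (e * letter_eval al be t) = 1.
  by apply: m_offE => /= onet; apply: (off_t 0%N); rewrite take0 /= mulg1.
have eval2 r : (letter_eval al' be' r).2 = letter_eval al be r.
  by case: r => x /=; rewrite ?al'E ?be'E.
rewrite !wreathM /= !eval2 !mul1g -/e rest mulg1.
have m1 := m_offE _ off_1; have me := m_onE _ on_e.
(* Exactly one of [s] and [t] is in [B]: if [t], it leaves the coset and contributes the inverse of
   [sg]; if [s], it enters the coset and contributes [sg]. *)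
case Es: s => [a|b]; case Et: t => [a'|b'] /=; rewrite Es Et in st; try by [].
  rewrite al'E be'E /= mul1g mulg1 me.
  rewrite [X in m (e * X)](_ : _ = letter_eval al be t).
    by rewrite off_et mulg1 => /(congr1 inv); rewrite invgK invg1.
  by rewrite Et.
rewrite al'E be'E /= !mulg1 mul1g m1 invg1 mul1g.
by rewrite [be b](_ : _ = e) ?me // /e Es.
Qed.

End Separation.

Theorem theorem2 (C : groupType -> Prop)
    (rootC : root_class C)
    (nontrivC : nontrivial_class C)
    (quotC : quotient_closed C)
    (A B : groupType)
    (nilA : nilpotent_group A) (nilB : nilpotent_group B)
    (CA : C A) (CB : C B)
    (H : groupClosed A) (K : groupClosed B)
    (phi : {multiplicative subgroup H -> subgroup K})
    (phi_bij : bijective phi)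
    (n : nat) (As : nat -> normalClosed A) (Bs : nat -> normalClosed B)
    (centralA : central_series n As) (centralB : central_series n Bs)
    (compat : forall i : nat, (1 <= i <= n)%N ->
       [set val (phi h) | h in [set h : subgroup H | val h \in As i]] =
       [set y : B | y \in Bs i /\ y \in K]) :
  (exists (Q : groupType) (f : {multiplicative amalgam phi -> Q}),
     [/\ C Q, solvable_group Q, surjective f,
         injective (fun a => f (amalgam_inl phi a)) &
         injective (fun b => f (amalgam_inr phi b))])
  /\ residually (solvable_in C) (amalgam phi).

Proof.
have [psi psiK _] := phi_bij; have phi_inj := can_inj psiK.
have AB i (h : subgroup H) : i <= n -> val h \in As i <-> val (phi h) \in Bs i.
  (* The hypothesis starts at index 1; at 0 both terms are trivial and injectivity of [phi]
     suffices. *)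
  case: i => [_|i i_n].
    have [A0 _ _ _] := centralA; have [B0 _ _ _] := centralB.
    rewrite A0 B0 !inE; split=> /eqP h1; apply/eqP.
      have -> : h = 1 by apply: val_inj; rewrite val1.
      by rewrite (morph_1 phi) val1.
    have -> : h = 1; last exact: val1.
    by apply: phi_inj; apply: val_inj; rewrite (morph_1 phi) val1.
  have /seteqP[sub sup] := compat i.+1 i_n; split=> hi.
    by have [] := sub (val (phi h)) (ex_intro2 _ _ h hi erefl).
  have [|k kA /val_inj/phi_inj <- //] := sup (val (phi h)).
  by split=> //; apply: valP.
have [Q [al [be [solQ compatQ al_inj be_inj]]]] :=
  compatible_central_series rootC quotC CA CB centralA centralB AB.
have [f [fA fB]] := amalgam_lift compatQ.
have [R [g [i [solR g_surj gE]]]] := image_factorization f rootC solQ.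
have gA_inj : injective (fun a => g (amalgam_inl phi a)).
  by move=> a a' /(congr1 i); rewrite !gE !fA => /al_inj.
have gB_inj : injective (fun b => g (amalgam_inr phi b)).
  by move=> b b' /(congr1 i); rewrite !gE !fB => /be_inj.
split; first by exists R, g; case: solR.
move=> x x1; have [[s xE]|[s [t [w [/= st xE]]]]] := reduced_form x phi_bij.
  (* A single letter is detected by injectivity on its factor. *)
  exists R, g; split=> // gx1; apply: x1; rewrite xE.
  case: s xE => y xE; move: gx1; rewrite xE /= -(morph_1 g).
    by rewrite -[in RHS](morph_1 (amalgam_inl phi)) => /gA_inj->; rewrite morph_1.
  by rewrite -[in RHS](morph_1 (amalgam_inr phi)) => /gB_inj->; rewrite morph_1.
have sH : ~~ in_amalgamated H K s by case/andP: st => /and3P[].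
have [T [al' [be' [solT compatT al'_inj be'_inj sep]]]] :=
  separate_prefixes rootC nontrivC solQ compatQ al_inj be_inj
    (st : path _ s (t :: w)) sH.
have [f' [f'A f'B]] := amalgam_lift compatT.
have f'E v : f' (amalgam_word phi v) = word_eval al' be' v.
  elim: v => [|r v IHv] /=; first exact: morph_1 f'.
  by rewrite amalgam_word_cons gmulfM IHv; case: r => y /=; rewrite ?f'A ?f'B.
have [R' [g' [i' [solR' g'_surj g'E]]]] := image_factorization f' rootC solT.
exists R', g'; split=> // /(congr1 i'); rewrite g'E xE f'E morph_1 => w1.
(* The whole word is its own longest prefix, and the excluded element of [H] is 1. *)
by apply: (sep (size [:: s, t & w]) 1); rewrite ?take_size ?val1 ?morph_1.
Qed.
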